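(* Let $M$ be a von Neumann algebra on a complex Hilbert space $H$, let $\xi_o\in H$, let $(\xi_k)_{k\ge 1}$ be a sequence in $\overline{M\xi_o}$, and let $(\gamma_k)_{k\ge 1}$ be a sequence in $(0,+\infty)$ such that $$\sum_{k=1}^{\infty}\frac{1}{\gamma_k}\,\|\xi_k\|^2<+\infty .$$ Then there exist $a\in M$ with $0\le a\le 1$, a vector $\eta_o\in \overline{aH}\cap\overline{M\xi_o}=\overline{aM\xi_o}$ (the equality of these two sets being part of the assertion), and a sequence $(b_k)_{k\ge 1}$ in the operator norm closure of $Ma$, such that $$a\,\eta_o=\xi_o,\qquad b_k\eta_o=\xi_k\ \text{ and }\ \|b_k\|\le\sqrt{\gamma_k}\quad\text{for all } k\ge 1 .$$
   Context: Bars denote norm closures in $H$; $M\xi_o=\{x\xi_o : x\in M\}$, $aM\xi_o=\{ax\xi_o : x\in M\}$, $Ma=\{xa : x\in M\}$. *)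

(* Defs.v *)
From HB Require Import structures.
From mathcomp Require Import all_boot all_order all_algebra.
From mathcomp Require Import complex.
From mathcomp Require Import all_classical all_reals all_analysis.

Set Implicit Arguments.
Unset Strict Implicit.
Unset Printing Implicit Defensive.

Import Order.TTheory GRing.Theory Num.Theory.
Import numFieldNormedType.Exports.

Local Open Scope classical_set_scope.
Local Open Scope ring_scope.

(* Operators on H are functions H -> H, with their pointwise vector space
   structure; composition is \o and the unit is idfun. *)
Section HilbertOperators.
Variables (R : realType) (H : completeNormedModType R[i]).
Implicit Types (S T : H -> H) (A M : set (H -> H)).

(* The norm of an R[i]-module is R[i]-valued (with real nonnegative values);
   this is the same norm with codomain R. *)
Definition hnorm (x : H) : R := complex.Re `|x|.

Definition bounded_operator T : Prop :=
  linear T /\ exists m : R, forall x, hnorm (T x) <= m * hnorm x.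

(* Meaningful for bounded operators only: sup is 0 on unbounded sets. *)
Definition opnorm T : R := sup [set hnorm (T x) | x in [set x | hnorm x <= 1]].

Definition opnorm_closure A : set (H -> H) :=
  [set T | bounded_operator T /\
    forall e : R, 0 < e -> exists2 S, A S & opnorm (T - S) < e].

(* dot is linear in its first argument and conjugate-linear in the second. *)
Variable dot : {dot H for @Num.conj R[i]}.

(* With the completeness of H, this makes (H, dot) a Hilbert space. *)
Definition hilbert_norm : Prop := forall x : H, `|x| ^+ 2 = dot x x.

Definition is_adjoint T S : Prop := forall x y, dot (T x) y = dot x (S y).

(* The order of self-adjoint operators. The order of R[i] only compares numbers
   with the same imaginary part, so that dot ((T - S) x) x is real here. *)
Definition op_le S T : Prop := forall x, 0 <= dot ((T - S) x) x.

Definition weak_op_cvg (F : set_system (H -> H)) T : Prop :=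
  forall x y, dot (f x) y @[f --> F] --> dot (T x) y.

Record von_neumann_algebra M : Prop := {
  vna_bounded : forall T, M T -> bounded_operator T;
  vna_id : M idfun;
  vna_linear : forall (c : R[i]) S T, M S -> M T -> M (c *: S + T);
  vna_comp : forall S T, M S -> M T -> M (S \o T);
  vna_adjoint : forall T, M T -> exists2 S, M S & is_adjoint T S;
  vna_weakly_closed : forall (F : set_system (H -> H)) T,
    ProperFilter F -> F M -> bounded_operator T -> weak_op_cvg F T -> M T
}.

End HilbertOperators.

(* Main.v *)
Require Import Defs.
From HB Require Import structures.
From mathcomp Require Import all_boot all_order all_algebra.
From mathcomp Require Import complex.
From mathcomp Require Import all_classical all_reals all_analysis.
From mathcomp Require Import ring lra.

Set Implicit Arguments.
Unset Strict Implicit.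
Unset Printing Implicit Defensive.

Import Order.TTheory GRing.Theory Num.Theory.
Import numFieldNormedType.Exports.

Local Open Scope classical_set_scope.
Local Open Scope ring_scope.

(** Let [x_(k,n)] be elements of [M] with [xi_k = sum_n x_(k,n) xio], the series
converging fast, and let [w_(k,n) = 4 ^ (n+1) / gamma_k]. The positive quadratic
form
[[
  h = 1 + sum_(k,n) w_(k,n) x_(k,n)^* x_(k,n)
]]
is unbounded in general, but it is finite at [xio]: the terms [n = 0] contribute
about [4 ||xi_k||^2 / gamma_k], which is summable by hypothesis, and the other
terms are as small as desired. Formally the solution is [a = h^(-1/2)],
[etao = h^(1/2) xio] and [b_k = sum_n x_(k,n) a]. Indeed
[w_(k,n) x_(k,n)^* x_(k,n) <= h] gives
[||x_(k,n) a|| <= w_(k,n)^(-1/2) = sqrt gamma_k / 2 ^ (n+1)], so that the series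
of [b_k] converges in operator norm with [||b_k|| <= sqrt gamma_k], and
[b_k etao = sum_n x_(k,n) xio = xi_k].

To stay among bounded operators, [h] is replaced by its finite partial sums
[h_N]. Their inverses decrease with [N], hence converge strongly to some [g] in
[M], and [a] is the square root of [g] ([form_sum_inverse_sqrt]). The vector
[etao] is obtained from
[[
  |<xio, y>|^2 <= <h_N xio, xio> <h_N^-1 y, y>,
]]
which bounds [|<xio, y>|] by a multiple of [||a y||]: minimising
[||a y||^2 - 2 Re <xio, y>] over [y] in [M xio] then produces a solution of
[a etao = xio] in the closure of [a M xio] ([solve_in_closure]). The same
minimisation, with [a zeta] in place of [xio], shows that a vector [zeta] of
the closures of [a H] and of [M xio] is in the closure of [a M xio]
([closure_range_orbit]).

The membership of [a] in [M] comes from one fact: a bounded increasing sequence of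
positive elements of [M] converges strongly in [M] ([vna_increasing_cvg]). It
provides [g], and also the inverses and the square root, as limits of iterations
whose terms are polynomials with nonnegative coefficients in one positive
element. *)

(** * The real inner product *)

Section RealInnerProduct.
Variables (R : realType) (H : completeNormedModType R[i]).
Variable dot : {dot H for @Num.conj R[i]}.
Hypothesis Hdot : hilbert_norm dot.

(** Positivity, symmetry and norms of complex linear operators are all visible on
the real part of the inner product, which takes values in the ordered field [R];
the imaginary part is recovered by [dot_rdot]. *)
Definition rdot (x y : H) : R := complex.Re (dot x y).

Definition rscale (c : R) (x : H) : H := real_complex R c *: x.

Lemma Re_scale (c : R) (z : R[i]) :
  complex.Re (real_complex R c * z) = c * complex.Re z.
Proof. by case: z => u v; simpc. Qed.

Lemma Re_conji (z : R[i]) : complex.Re ('i%C^* * z) = complex.Im z.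
Proof. by case: z => u v; simpc. Qed.

Lemma rdotDl x y z : rdot (x + y) z = rdot x z + rdot y z.
Proof. by rewrite /rdot linearDl raddfD. Qed.

Lemma rdotBl x y z : rdot (x - y) z = rdot x z - rdot y z.
Proof. by rewrite /rdot linearBl raddfB. Qed.

Lemma rdot0l z : rdot 0 z = 0.
Proof. by rewrite /rdot linear0l. Qed.

Lemma rdotZl c x y : rdot (rscale c x) y = c * rdot x y.
Proof.
rewrite /rdot /rscale linearZl_LR.
exact: Re_scale.
Qed.

Lemma Re_conj (z : R[i]) : complex.Re z^* = complex.Re z.
Proof. by case: z. Qed.

Lemma dotC x y : dot x y = (dot y x)^*.
Proof. by rewrite (hermC dot) expr0 mul1r. Qed.

Lemma rdotC x y : rdot x y = rdot y x.
Proof. by rewrite /rdot dotC Re_conj. Qed.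

Lemma rdotDr x y z : rdot z (x + y) = rdot z x + rdot z y.
Proof. by rewrite rdotC rdotDl !(rdotC z). Qed.

Lemma rdotBr x y z : rdot z (x - y) = rdot z x - rdot z y.
Proof. by rewrite rdotC rdotBl !(rdotC z). Qed.

Lemma rdot0r z : rdot z 0 = 0.
Proof. by rewrite rdotC rdot0l. Qed.

Lemma rdotZr c x y : rdot y (rscale c x) = c * rdot y x.
Proof. by rewrite rdotC rdotZl rdotC. Qed.

Lemma dot_rdot x y : dot x y = Complex (rdot x y) (rdot x ('i%C *: y)).
Proof.
have -> : rdot x ('i%C *: y) = complex.Im (dot x y).
  rewrite /rdot linearZr_LR; exact: Re_conji.
by rewrite /rdot; case: (dot x y).
Qed.

Lemma norm_hnorm (x : H) : `|x| = real_complex R (hnorm x).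
Proof. by rewrite /hnorm RRe_real // ger0_real. Qed.

Lemma hnorm_ge0 (x : H) : 0 <= hnorm x.
Proof. by rewrite -ler0c -norm_hnorm. Qed.

Lemma hnorm_sqr x : hnorm x ^+ 2 = rdot x x.
Proof.
by rewrite /rdot -Hdot norm_hnorm -rmorphXn.
Qed.

Lemma rdot_ge0 x : 0 <= rdot x x.
Proof. by rewrite -hnorm_sqr sqr_ge0. Qed.

Lemma hnormD (x y : H) : hnorm (x + y) <= hnorm x + hnorm y.
Proof. by rewrite -lecR rmorphD /= -!norm_hnorm ler_normD. Qed.

Lemma hnormN (x : H) : hnorm (- x) = hnorm x.
Proof. by rewrite /hnorm normrN. Qed.

Lemma hnorm0 : hnorm (0 : H) = 0.
Proof. by rewrite /hnorm normr0. Qed.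

Lemma hdistC (x y : H) : hnorm (x - y) = hnorm (y - x).
Proof. by rewrite -hnormN opprB. Qed.

Lemma hdistD (y x z : H) : hnorm (x - z) <= hnorm (x - y) + hnorm (y - z).
Proof. by rewrite -[x - z](subrKA y) hnormD. Qed.

Lemma hnorm0_eq0 (x : H) : hnorm x = 0 -> x = 0.
Proof. by move=> x0; apply/eqP; rewrite -normr_eq0 norm_hnorm x0. Qed.

Lemma hnormZ c (x : H) : hnorm (rscale c x) = `|c| * hnorm x.
Proof.
apply: complexI; rewrite rmorphM /= -!norm_hnorm normrZ; congr (_ * _).
by rewrite normc_def /= expr0n addr0 sqrtr_sqr.
Qed.

Lemma hnormZc (c : R[i]) (x : H) : hnorm (c *: x) = complex.Re `|c| * hnorm x.
Proof.
by apply: complexI; rewrite rmorphM /= -!norm_hnorm normrZ.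
Qed.

Lemma hnorm_dist (x y : H) : `|hnorm x - hnorm y| <= hnorm (x - y).
Proof.
have hD (u v : H) : hnorm u - hnorm v <= hnorm (u - v) :> R.
  by rewrite lerBlDr -[X in hnorm X <= _](subrK v) hnormD.
by rewrite ler_norml hD andbT lerNl opprB hdistC hD.
Qed.

Lemma rscale1 x : rscale 1 x = x.
Proof. by rewrite /rscale scale1r. Qed.

Lemma rscaleA c d x : rscale c (rscale d x) = rscale (c * d) x.
Proof. by rewrite /rscale scalerA rmorphM. Qed.

Lemma rscaleDl c d x : rscale (c + d) x = rscale c x + rscale d x.
Proof. by rewrite /rscale rmorphD scalerDl. Qed.

Lemma rscaleBr c x y : rscale c (x - y) = rscale c x - rscale c y.
Proof. by rewrite /rscale scalerBr. Qed.

Lemma quadratic_ge0_discr (A B C : R) : 0 <= C ->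
  (forall t, 0 <= A + 2 * t * B + t ^+ 2 * C) -> B ^+ 2 <= A * C.
Proof.
move=> C0 h; have [C_eq0|C_neq0] := eqVneq C 0; last first.
  have Cp : 0 < C by rewrite lt_def C_neq0.
  have := h (- B / C).
  have -> : A + 2 * (- B / C) * B + (- B / C) ^+ 2 * C = (A * C - B ^+ 2) / C.
    by field.
  by rewrite pmulr_lge0 ?invr_gt0 // subr_ge0.
have [->|B0] := eqVneq B 0; first by rewrite expr0n /= C_eq0 mulr0.
(* With C = 0 the form is affine in t; at this t it takes the value -1. *)
have := h (- (A + 1) / (2 * B)).
have -> : A + 2 * (- (A + 1) / (2 * B)) * B + (- (A + 1) / (2 * B)) ^+ 2 * C
   = -1 by rewrite C_eq0; field; rewrite B0.
by rewrite lerNr oppr0 ler10.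
Qed.

(** Cauchy-Schwarz for the positive form [<T x, y>]. *)
Lemma form_cauchy_schwarz (T : H -> H) : linear T ->
  (forall x y, rdot (T x) y = rdot x (T y)) ->
  (forall x, 0 <= rdot (T x) x) ->
  forall x y, rdot (T x) y ^+ 2 <= rdot (T x) x * rdot (T y) y.
Proof.
move=> Tlin Tsa Tpos x y; apply: quadratic_ge0_discr => // t.
have := Tpos (rscale t y + x).
rewrite /rscale Tlin -!/(rscale _ _).
rewrite !(rdotDl, rdotDr, rdotZl, rdotZr) [rdot (T y) x]rdotC -Tsa.
set a := rdot _ _; set b := rdot _ _; set c := rdot _ _.
suff -> : t * (t * a + b) + (t * b + c) = c + 2 * t * b + t ^+ 2 * a by [].
by ring.
Qed.

Lemma cauchy_schwarz x y : `|rdot x y| <= hnorm x * hnorm y.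
Proof.
rewrite -(@ler_pXn2r _ 2) ?nnegrE ?mulr_ge0 ?hnorm_ge0 //.
rewrite real_normK ?num_real // exprMn !hnorm_sqr.
by apply: (@form_cauchy_schwarz id) => //; exact: rdot_ge0.
Qed.

Lemma rdot_le x y : rdot x y <= hnorm x * hnorm y.
Proof. exact: le_trans (ler_norm _) (cauchy_schwarz x y). Qed.

Lemma linear_rules (T : H -> H) : linear T ->
  [/\ forall x y, T (x + y) = T x + T y, forall x y, T (x - y) = T x - T y,
      T 0 = 0, forall c x, T (rscale c x) = rscale c (T x)
    & forall c x, T (c *: x) = c *: T x].
Proof.
move=> Tl.
have T0 : T 0 = 0.
  by have := Tl (-1) 0 0; rewrite scaler0 addr0 scaleN1r addNr.
have TZ c x : T (c *: x) = c *: T x.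
  by have := Tl c x 0; rewrite !addr0 T0 addr0.
split => //.
- by move=> x y; have := Tl 1 x y; rewrite !scale1r.
- by move=> x y; have := Tl (-1) y x; rewrite !scaleN1r ![- _ + _]addrC.
- by move=> c x; exact: TZ.
Qed.

(** Cauchy-Schwarz for the form of [T], applied to [x] and [T x]. This is what
turns convergence of quadratic forms into strong convergence. *)
Lemma hnorm_pos_le (T : H -> H) q : 0 <= q -> linear T ->
  (forall x y, rdot (T x) y = rdot x (T y)) ->
  (forall x, 0 <= rdot (T x) x) ->
  (forall x, rdot (T x) x <= q * rdot x x) ->
  forall x, hnorm (T x) ^+ 2 <= q * rdot (T x) x.
Proof.
move=> q0 Tl Tsa Tpos Tq x; rewrite hnorm_sqr.
have := form_cauchy_schwarz Tl Tsa Tpos x (T x).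
have := Tq (T x); have := Tpos x; have := rdot_ge0 (T x).
set A := rdot (T x) (T x); set B := rdot (T x) x; set C := rdot (T (T x)) _.
move=> A0 B0 CA AB; have [->|An0] := eqVneq A 0; first exact: mulr_ge0.
have Ap : 0 < A by rewrite lt_def An0.
rewrite -(ler_pM2l Ap) -expr2; apply: (le_trans AB).
by have -> : A * (q * B) = B * (q * A) by [ring]; rewrite ler_wpM2l.
Qed.

Lemma hnorm_pos_bound (T : H -> H) q : 0 <= q -> linear T ->
  (forall x y, rdot (T x) y = rdot x (T y)) ->
  (forall x, 0 <= rdot (T x) x) ->
  (forall x, rdot (T x) x <= q * rdot x x) ->
  forall x, hnorm (T x) <= q * hnorm x.
Proof.
move=> q0 Tl Tsa Tpos Tq x.
rewrite -(@ler_pXn2r _ 2) ?nnegrE ?mulr_ge0 ?hnorm_ge0 //.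
apply: (le_trans (hnorm_pos_le q0 Tl Tsa Tpos Tq x)).
by rewrite exprMn hnorm_sqr expr2 -mulrA ler_wpM2l.
Qed.

End RealInnerProduct.

(** * Convergent sequences of vectors *)

Section Convergence.
Variables (R : realType) (H : completeNormedModType R[i]).
Implicit Types (u v : nat -> H) (x y l : H) (A : set H).

(** Convergence is stated through the [R]-valued norm, so that the order and the
squeeze lemmas of [R] apply; the norm of [H] itself is valued in [R[i]]. *)
Definition hcvg u l : Prop := hnorm (u n - l) @[n --> \oo] --> (0 : R).

Lemma hcvg_le u l (e : nat -> R) :
  (forall n, hnorm (u n - l) <= e n) -> e @ \oo --> (0 : R) -> hcvg u l.
Proof.
move=> ue e0; apply: (@squeeze_cvgr _ _ _ _ (cst 0) e) => //.
- by apply: nearW => n; rewrite hnorm_ge0 ue.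
- exact: cvg_cst.
Qed.

Lemma hcvg_cst l : hcvg (fun=> l) l.
Proof.
apply: (@hcvg_le _ _ (cst 0)); last exact: cvg_cst.
by move=> n; rewrite subrr hnorm0.
Qed.

Lemma hcvg_eventually u l e : 0 < e -> hcvg u l ->
  exists N, forall n, (N <= n)%N -> hnorm (u n - l) < e.
Proof.
move=> e0 /cvgrPdist_lt /(_ _ e0) [N _ hN]; exists N => n Nn.
by have := hN n Nn; rewrite /= sub0r normrN ger0_norm ?hnorm_ge0.
Qed.

Lemma hcvg_unique u l m : hcvg u l -> hcvg u m -> l = m.
Proof.
move=> ul um; apply/eqP; rewrite -subr_eq0; apply/eqP/hnorm0_eq0.
suff : hcvg (fun=> l) m.
  by move/(cvg_lim (@Rhausdorff R)) <-; rewrite lim_cst.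
apply: (@hcvg_le _ _ (fun n => hnorm (u n - l) + hnorm (u n - m))).
  by move=> n; rewrite [X in _ <= X + _]hdistC hdistD.
by rewrite -[0](addr0 0); exact: cvgD ul um.
Qed.

Lemma hcvgD u v l m : hcvg u l -> hcvg v m ->
  hcvg (fun n => u n + v n) (l + m).
Proof.
move=> ul vm.
apply: (@hcvg_le _ _ (fun n => hnorm (u n - l) + hnorm (v n - m))).
  by move=> n; rewrite opprD addrACA hnormD.
by rewrite -[0](addr0 0); exact: cvgD ul vm.
Qed.

Lemma hcvg_lipschitz (T : H -> H) (C : R) u l :
  (forall x y, hnorm (T x - T y) <= C * hnorm (x - y)) ->
  hcvg u l -> hcvg (fun n => T (u n)) (T l).
Proof.
move=> TC ul; apply: (@hcvg_le _ _ (fun n => C * hnorm (u n - l))) => //.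
by rewrite -[0](mulr0 C); apply: cvgM => //; exact: cvg_cst.
Qed.

Lemma hcvgB u v l m : hcvg u l -> hcvg v m ->
  hcvg (fun n => u n - v n) (l - m).
Proof.
move=> ul vm; apply: hcvgD => //; apply: (@hcvg_lipschitz _ 1) => // x y.
by rewrite mul1r -opprD hnormN.
Qed.

Lemma hcvgZ c u l : hcvg u l -> hcvg (fun n => rscale c (u n)) (rscale c l).
Proof.
by apply: (@hcvg_lipschitz _ `|c|) => x y; rewrite -rscaleBr hnormZ.
Qed.

Lemma hcvg_norm u l : hcvg u l -> hnorm (u n) @[n --> \oo] --> hnorm l.
Proof.
move=> ul; apply/cvgrPdist_lt => e e0.
have [N hN] := hcvg_eventually e0 ul; exists N => // n Nn /=.
by apply: le_lt_trans (hN n Nn); rewrite distrC hnorm_dist.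
Qed.

Lemma hcvg_le_norm u l (C : R) :
  hcvg u l -> (forall n, hnorm (u n) <= C) -> hnorm l <= C.
Proof.
move=> /hcvg_norm ul uC; rewrite -(cvg_lim _ ul) //.
apply: limr_le; first by apply/cvg_ex; exists (hnorm l).
exact: nearW.
Qed.

Lemma hclosureP A l :
  closure A l <-> forall e : R, 0 < e -> exists2 x, A x & hnorm (x - l) < e.
Proof.
split=> [Al e e0|h B /nbhs_ballP[e /= e0 lB]].
  have /Al[x [Ax]] : nbhs l (ball l (real_complex R e)).
    by apply: nbhsx_ballx; rewrite ltcE /= eqxx.
  by rewrite -ball_normE /= distrC norm_hnorm ltcR => xl; exists x.
have [x Ax xl] := h (complex.Re e) ltac:(by move: e0; rewrite ltcE => /andP[]).
exists x; split=> //; apply: lB; rewrite -ball_normE /= distrC norm_hnorm.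
by rewrite -[e]RRe_real ?ltcR // gtr0_real.
Qed.

Lemma hclosure_seq A l : closure A l ->
  exists2 u : nat -> H, forall n, A (u n) & hcvg u l.
Proof.
move=> /hclosureP Al.
have h n : {x | A x & hnorm (x - l) < n.+1%:R^-1}.
  by apply: cid2; apply: Al; rewrite invr_gt0 ltr0n.
exists (fun n => s2val (h n)) => [n|]; first exact: (s2valP (h n)).
apply: (@hcvg_le _ _ (fun n => n.+1%:R^-1)) => [n|].
  exact: ltW (s2valP' (h n)).
exact: cvg_harmonic.
Qed.

Lemma hcvg_closure A u l : (forall n, A (u n)) -> hcvg u l -> closure A l.
Proof.
move=> Au ul; apply/hclosureP => e e0.
by have [N hN] := hcvg_eventually e0 ul; exists (u N) => //; exact: hN.
Qed.

Lemma hcauchy_cvg u :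
  (forall e : R, 0 < e ->
     exists N, forall n, (N <= n)%N -> hnorm (u n - u N) < e) ->
  exists l, hcvg u l.
Proof.
move=> hu.
have : cvg (u @ \oo).
  apply/cauchy_cvgP/cauchy_exP => e e0.
  have [N hN] := hu (complex.Re e) ltac:(by move: e0; rewrite ltcE => /andP[]).
  exists (u N), N => // n Nn; rewrite -ball_normE /= distrC norm_hnorm.
  by rewrite -[e]RRe_real ?ltcR ?gtr0_real //; exact: hN.
move=> /cvg_ex[l ul]; exists l; apply/cvgrPdist_lt => e e0.
have /cvgrPdist_lt /(_ (real_complex R e)) := ul.
rewrite ltcE /= eqxx => /(_ e0)[N _ hN]; exists N => // n Nn /=.
have := hN n Nn; rewrite /= distrC norm_hnorm ltcR sub0r normrN ger0_norm //.
exact: hnorm_ge0.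
Qed.

End Convergence.

(** * Von Neumann algebras and monotone limits *)

Section Algebra.
Variables (R : realType) (H : completeNormedModType R[i]).
Variable dot : {dot H for @Num.conj R[i]}.
Hypothesis Hdot : hilbert_norm dot.
Local Notation "<< x , y >>" := (rdot dot x y).

Lemma hcvg_rdot (u : nat -> H) l y :
  hcvg u l -> rdot dot (u n) y @[n --> \oo] --> rdot dot l y.
Proof.
move=> ul; apply/subr_cvg0.
have h0 : hnorm (u n - l) * hnorm y @[n --> \oo] --> (0 : R).
  by rewrite -[0](mul0r (hnorm y)); apply: cvgM => //; exact: cvg_cst.
apply: (@squeeze_cvgr _ _ _ _ (fun n => - (hnorm (u n - l) * hnorm y))
                              (fun n => hnorm (u n - l) * hnorm y)) => //.
- by apply: nearW => n; rewrite -ler_norml /= -rdotBl cauchy_schwarz.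
- by rewrite -oppr0; exact: cvgN.
Qed.

Lemma normc_le (z : R[i]) :
  `|z| <= real_complex R (`|complex.Re z| + `|complex.Im z|).
Proof.
rewrite normc_def lecR -[leRHS]ger0_norm ?addr_ge0 // -sqrtr_sqr ler_wsqrtr //.
rewrite sqrrD !real_normK ?num_real // lerD2r lerDl.
by rewrite mulrn_wge0 // mulr_ge0.
Qed.

Lemma norm_dot_le (x y : H) : `|dot x y| <= real_complex R (2 * hnorm x * hnorm y).
Proof.
apply: (le_trans (normc_le _)); rewrite lecR dot_rdot /=.
rewrite -mulrA mulrDl mul1r lerD ?cauchy_schwarz //.
apply: (le_trans (cauchy_schwarz _ _ _)) => //; rewrite ler_wpM2l ?hnorm_ge0 //.
by rewrite /hnorm normrZ normc_def /= expr0n add0r expr1n sqrtr1 mul1r.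
Qed.

Variable M : set (H -> H).
Hypothesis HM : von_neumann_algebra dot M.

Lemma vna_lin T : M T -> linear T.
Proof. by move=> /(vna_bounded HM)[]. Qed.

Lemma vna_bound T : M T ->
  exists2 C : R, 0 < C & forall x, hnorm (T x) <= C * hnorm x.
Proof.
move=> /(vna_bounded HM)[_ [m hm]]; exists (`|m| + 1).
  by rewrite ltr_wpDl.
move=> x; apply: (le_trans (hm x)); rewrite ler_wpM2r ?hnorm_ge0 //.
by rewrite (le_trans (ler_norm _)) // lerDl.
Qed.

Lemma vna_add S T : M S -> M T -> M (fun x => S x + T x).
Proof.
move=> MS MT; rewrite (_ : (fun x => _) = 1 *: S + T); first exact: (vna_linear HM).
by apply/funext => x; rewrite /= scale1r.
Qed.

Lemma vna_zero : M (fun=> 0).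
Proof.
rewrite (_ : (fun x => _) = (-1) *: idfun + idfun).
  by apply: (vna_linear HM) => //; exact: vna_id HM.
by apply/funext => x /=; rewrite /= scaleN1r addNr.
Qed.

Lemma vna_rscale c T : M T -> M (fun x => rscale c (T x)).
Proof.
move=> MT; rewrite (_ : (fun x => _) = (real_complex R c) *: T + (fun=> 0)).
  by apply: (vna_linear HM) => //; exact: vna_zero.
by apply/funext => x /=; rewrite addr0.
Qed.

Lemma vna_sub S T : M S -> M T -> M (fun x => S x - T x).
Proof.
move=> MS MT; rewrite (_ : (fun x => _) = (-1) *: T + S); first exact: (vna_linear HM).
by apply/funext => x; rewrite /= scaleN1r addrC.
Qed.

Lemma vna_adj T : M T ->
  exists2 S, M S & forall x y, <<T x, y>> = <<x, S y>>.
Proof.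
by move=> /(vna_adjoint HM)[S MS TS]; exists S => // x y; rewrite /rdot TS.
Qed.

(** Uniform boundedness makes the pointwise limit bounded, and pointwise
convergence implies weak convergence along the image of the filter of [nat]. *)
Lemma vna_lim (T : nat -> H -> H) S (C : R) : (forall n, M (T n)) ->
  (forall n x, hnorm (T n x) <= C * hnorm x) ->
  (forall x, hcvg (fun n => T n x) (S x)) -> M S.
Proof.
move=> MT TC TS.
have F : ProperFilter (T @ \oo) by apply: fmap_proper_filter.
apply: (vna_weakly_closed HM) F _ _ _.
- by exists 0 => // n _; exact: MT.
- split; last by exists C => x; apply: hcvg_le_norm (TS x) _.
  move=> c x y; apply: (hcvg_unique (TS _)).
  rewrite (_ : (fun n => _) = (fun n => c *: T n x + T n y)); last first.
    by apply/funext => n; rewrite (vna_lin (MT n)).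
  apply: hcvgD => //; apply: (@hcvg_lipschitz _ _ _ (complex.Re `|c|)) => // u v.
  by rewrite -scalerBr hnormZc.
- move=> x y; apply/cvgrPdist_lt => e e0.
  have e0' : 0 < complex.Re e by move: e0; rewrite ltcE => /andP[].
  have d0 : 0 < complex.Re e / (2 * hnorm y + 1).
    by rewrite divr_gt0 // ltr_wpDl // mulr_ge0 ?hnorm_ge0.
  have [N hN] := hcvg_eventually d0 (TS x); exists N => // n Nn /=.
  rewrite distrC -linearBl; apply: (le_lt_trans (norm_dot_le _ _)).
  rewrite -[e]RRe_real ?gtr0_real // ltcR.
  have := hN n Nn; rewrite ltr_pdivlMr; last first.
    by rewrite ltr_wpDl // mulr_ge0 ?hnorm_ge0.
  apply: le_lt_trans; rewrite mulrAC mulrC ler_wpM2l ?hnorm_ge0 //.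
  by rewrite lerDl.
Qed.

Definition posM T : Prop :=
  [/\ M T, forall x y, <<T x, y>> = <<x, T y>> & forall x, 0 <= <<T x, x>>].

Lemma posM_add S T : posM S -> posM T -> posM (fun x => S x + T x).
Proof.
move=> [MS sS pS] [MT sT pT]; split; first exact: vna_add.
- by move=> x y; rewrite rdotDl rdotDr sS sT.
- by move=> x; rewrite rdotDl addr_ge0.
Qed.

Lemma posM_scale c T : 0 <= c -> posM T -> posM (fun x => rscale c (T x)).
Proof.
move=> c0 [MT sT pT]; split; first exact: vna_rscale.
- by move=> x y; rewrite rdotZl rdotZr sT.
- by move=> x; rewrite rdotZl mulr_ge0.
Qed.

Lemma posM_id : posM id.
Proof. by split=> //; [exact: vna_id HM | move=> x; exact: rdot_ge0]. Qed.

Lemma posM_zero : posM (fun=> 0).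
Proof.
split; first exact: vna_zero.
- by move=> x y; rewrite rdot0l rdot0r.
- by move=> x; rewrite rdot0l.
Qed.

Lemma posM_sub S T : posM S -> posM T ->
  (forall x, <<T x, x>> <= <<S x, x>>) -> posM (fun x => S x - T x).
Proof.
move=> [MS sS _] [MT sT _] TS; split; first exact: vna_sub.
- by move=> x y; rewrite rdotBl rdotBr sS sT.
- by move=> x; rewrite rdotBl subr_ge0.
Qed.

Lemma posM_bound T q : 0 <= q -> posM T ->
  (forall x, <<T x, x>> <= q * <<x, x>>) ->
  forall x, hnorm (T x) <= q * hnorm x.
Proof.
by move=> q0 [/vna_lin lT sT pT] Tq; exact: (hnorm_pos_bound Hdot).
Qed.

(** [<T x, x>] is real by symmetry: the real inner product of [T x] with [i x] is
its own opposite. *)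
Lemma posM_dot_ge0 T : posM T -> forall x, 0 <= dot (T x) x.
Proof.
move=> [MT sT pT] x; have [_ _ _ _ TZ] := linear_rules (vna_lin MT).
have Im0 : <<T x, 'i%C *: x>> = 0.
  have ImE y z : <<y, 'i%C *: z>> = complex.Im (dot y z) by rewrite dot_rdot.
  suff : <<T x, 'i%C *: x>> = - <<T x, 'i%C *: x>> by lra.
  rewrite {2}sT TZ !ImE dotC; by case: (dot x (T x)).
by rewrite dot_rdot Im0 lecE /= eqxx pT.
Qed.

(** The numbers [<T n x, x>] increase to a limit. For [N <= n] the operator
[D = T n - T N] is positive and bounded by [C], so [||D x||^2 <= C <D x, x>], and
[T n x] is a Cauchy sequence. *)
Lemma vna_increasing_cvg (T : nat -> H -> H) C : 0 <= C ->
  (forall n, posM (T n)) ->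
  (forall n x, <<T n x, x>> <= <<T n.+1 x, x>>) ->
  (forall n x, <<T n x, x>> <= C * <<x, x>>) ->
  exists S, [/\ posM S, forall x, hcvg (fun n => T n x) (S x),
    forall n x, <<T n x, x>> <= <<S x, x>> &
    forall x, <<S x, x>> <= C * <<x, x>>].
Proof.
move=> C0 pT T_incr T_le.
have T_mono x : nondecreasing_seq (fun n => <<T n x, x>>).
  by apply/nondecreasing_seqP => n.
have T_cvg x : cvgn (fun n => <<T n x, x>>).
  apply: nondecreasing_is_cvgn => //; exists (C * <<x, x>>) => _ [n _ <-].
  exact: T_le.
have T_lim x : exists l, hcvg (fun n => T n x) l.
  apply: hcauchy_cvg => e e0.
  have d0 : 0 < e ^+ 2 / (C + 1) by rewrite divr_gt0 ?exprn_gt0 // ltr_wpDl.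
  have /cvgrPdist_lt /(_ _ d0) [N _ hN] := T_cvg x; exists N => n Nn.
  have pD : posM (fun y => T n y - T N y).
    by apply: posM_sub => // y; exact: T_mono.
  have DC y : <<T n y - T N y, y>> <= C * <<y, y>>.
    by apply: le_trans (T_le n y); rewrite rdotBl gerBl; case: (pT N).
  have := hnorm_pos_le Hdot C0 (vna_lin (let: And3 m _ _ := pD in m))
    (let: And3 _ s _ := pD in s) (let: And3 _ _ p := pD in p) DC x.
  rewrite -(@ltr_pXn2r _ 2) ?nnegrE ?hnorm_ge0 ?(ltW e0) //.
  move=> /le_lt_trans; apply; apply: (@le_lt_trans _ _ ((C + 1) * <<T n x - T N x, x>>)).
    by rewrite ler_wpM2r ?lerDl //; case: pD.
  rewrite mulrC -ltr_pdivlMr ?ltr_wpDl //; apply: le_lt_trans (hN N (leqnn N)).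
  rewrite rdotBl ger0_norm ?subr_ge0 ?lerD2r; last first.
    exact: (nondecreasing_cvgn_le (T_mono x) (T_cvg x)).
  exact: (nondecreasing_cvgn_le (T_mono x) (T_cvg x)).
have [S TS] := choice T_lim.
have cvgS x : <<T n x, x>> @[n --> \oo] --> <<S x, x>>.
  exact: hcvg_rdot.
have le_S n x : <<T n x, x>> <= <<S x, x>>.
  by rewrite -(cvg_lim (@Rhausdorff R) (cvgS x)); apply: nondecreasing_cvgn_le.
exists S; split => //.
- split.
  + apply: (@vna_lim T S C) => // [n|n x]; first by case: (pT n).
    exact: posM_bound.
  + move=> x y; have E : (fun n => <<T n x, y>>) = (fun n => <<T n y, x>>).
      by apply/funext => n; rewrite [RHS]rdotC; case: (pT n).
    rewrite [RHS]rdotC -(cvg_lim (@Rhausdorff R) (hcvg_rdot (y := y) (TS x))) E.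
    exact: cvg_lim (hcvg_rdot (y := x) (TS y)).
  + by move=> x; apply: le_trans (le_S 0%N x); case: (pT 0%N).
- move=> x; rewrite -(cvg_lim (@Rhausdorff R) (cvgS x)).
  by apply: limr_le; [exact: T_cvg | exact: nearW].
Qed.

End Algebra.

(** * Inverses and square roots in a von Neumann algebra *)

Section SquareRootsAndInverses.
Variables (R : realType) (H : completeNormedModType R[i]).
Variable dot : {dot H for @Num.conj R[i]}.
Hypothesis Hdot : hilbert_norm dot.
Variable M : set (H -> H).
Hypothesis HM : von_neumann_algebra dot M.
Local Notation "<< x , y >>" := (rdot dot x y).
Local Notation posM := (posM dot M).

(** The polynomials in [t] with nonnegative coefficients. The iterations below
increase because their increments lie in this cone. *)
Inductive poly_cone (t : H -> H) : (H -> H) -> Prop :=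
| poly_cone_id : poly_cone t (fun x => x)
| poly_cone_mul p of poly_cone t p : poly_cone t (fun x => t (p x))
| poly_cone_add p q of poly_cone t p & poly_cone t q :
    poly_cone t (fun x => p x + q x)
| poly_cone_scale c p of 0 <= c & poly_cone t p :
    poly_cone t (fun x => rscale c (p x)).

Lemma poly_cone0 t : poly_cone t (fun=> 0).
Proof.
rewrite (_ : (fun=> 0) = fun x => rscale 0 x).
  by apply: poly_cone_scale => //; exact: poly_cone_id.
by apply/funext => x; rewrite /rscale scale0r.
Qed.

Lemma poly_cone_comp t p q :
  poly_cone t p -> poly_cone t q -> poly_cone t (fun x => p (q x)).
Proof.
move=> + tq; elim=> [|p' _ IH|p1 p2 _ IH1 _ IH2|c p' c0 _ IH] //.
- exact: poly_cone_mul IH.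
- exact: poly_cone_add IH1 IH2.
- exact: poly_cone_scale c0 IH.
Qed.

(** The powers of a positive [t] are positive: [t ^ (2 m)] is a square, and
[t ^ (2 m + 1) = t ^ m t t ^ m]. The induction proves both parities at once, by
carrying positivity of [p] and of [t p] together with [t p = p t]. *)
Lemma poly_cone_pos t p : posM t -> poly_cone t p -> posM p.
Proof.
move=> pt tp.
suff [] : [/\ posM p, posM (fun x => t (p x)) & forall x, t (p x) = p (t x)].
  by [].
have [Mt st post] := pt; have [tD tB t0 tZ _] := linear_rules (vna_lin HM Mt).
elim: tp => [|p' _ [pp ptp tpC]|p1 p2 _ [p1p tp1 C1] _ [p2p tp2 C2]
            |c p' c0 _ [pp ptp tpC]].
- by split=> //; exact: posM_id.
- have [Mp sp posp] := pp; have [Mtp _ _] := ptp.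
  split=> [//||x]; last by rewrite -tpC.
  split; first exact: (vna_comp HM Mt Mtp).
  + by move=> x y; rewrite st st sp -!tpC.
  + by move=> x; rewrite st tpC.
- split; first exact: posM_add.
  + rewrite (_ : (fun x => _) = fun x => t (p1 x) + t (p2 x)).
      exact: posM_add.
    by apply/funext => x; rewrite tD.
  + by move=> x; rewrite tD C1 C2.
- split; first exact: posM_scale.
  + rewrite (_ : (fun x => _) = fun x => rscale c (t (p' x))).
      exact: posM_scale.
    by apply/funext => x; rewrite tZ.
  + by move=> x; rewrite tZ tpC.
Qed.

Lemma contraction_le (T : H -> H) : (forall x, hnorm (T x) <= hnorm x) ->
  forall x, <<T x, x>> <= 1 * <<x, x>>.
Proof.
move=> T1 x; rewrite mul1r -(hnorm_sqr Hdot); apply: (le_trans (rdot_le Hdot _ _)).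
by rewrite expr2 ler_wpM2r ?hnorm_ge0.
Qed.

Lemma poly_cone_cvg t (r : nat -> H -> H) : posM t ->
  (forall n, poly_cone t (r n)) ->
  (forall n, poly_cone t (fun x => r n.+1 x - r n x)) ->
  (forall n x, hnorm (r n x) <= hnorm x) ->
  exists S, [/\ posM S, forall x, hcvg (fun n => r n x) (S x) &
    forall x, <<S x, x>> <= <<x, x>>].
Proof.
move=> pt tr tdr r1.
have [|n|n x|n x|S [pS rS _ S1]] := @vna_increasing_cvg _ _ _ Hdot _ HM r 1.
- by [].
- exact: poly_cone_pos (tr n).
- by rewrite -subr_ge0 -rdotBl; have [_ _] := poly_cone_pos pt (tdr n); apply.
- exact: contraction_le.
- by exists S; split=> // x; rewrite -[leRHS]mul1r.
Qed.

Lemma hcvg_shiftS (u : nat -> H) l : hcvg u l -> hcvg (fun n => u n.+1) l.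
Proof. by rewrite /hcvg -(cvg_shiftS (fun n => hnorm (u n - l))). Qed.

Lemma vna_cvg (T : H -> H) u l : M T -> hcvg u l -> hcvg (fun n => T (u n)) (T l).
Proof.
move=> MT; have [C _ hC] := vna_bound HM MT.
by apply: (@hcvg_lipschitz _ _ _ C) => x y; have [_ <- _ _ _] := linear_rules (vna_lin HM MT).
Qed.

(** With [h <= C] and [t = 1 - h / C], the inverse is the fixed point of
[g |-> 1 / C + t g]. The iterates from [0] are the partial sums of the Neumann
series of [h^-1]; they are contractions as [||t|| <= 1 - 1 / C]. *)
Lemma vna_inverse h : posM h -> (forall x, <<x, x>> <= <<h x, x>>) ->
  exists g, [/\ posM g, forall x, h (g x) = x & forall x, <<g x, x>> <= <<x, x>>].
Proof.
move=> ph h1; have [Mh sh posh] := ph.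
have [C0 C0_gt0 hC0] := vna_bound HM Mh.
pose C := C0 + 1; have C1 : 1 <= C by rewrite lerDr ltW.
have Cp : 0 < C by apply: lt_le_trans C1.
have hC x : hnorm (h x) <= C * hnorm x.
  by apply: (le_trans (hC0 x)); rewrite ler_wpM2r ?hnorm_ge0 // lerDl.
have iC0 : 0 <= C^-1 by rewrite invr_ge0 ltW.
have iC1 : 0 <= 1 - C^-1 by rewrite subr_ge0 invf_le1.
pose t x := x - rscale C^-1 (h x).
have pt : posM t.
  apply: posM_sub => //; [exact: posM_id|exact: posM_scale|move=> x].
  rewrite rdotZl ler_pdivrMl // -(hnorm_sqr Hdot) expr2 mulrA.
  by apply: (le_trans (rdot_le Hdot _ _)); rewrite ler_wpM2r ?hnorm_ge0.
have tq x : hnorm (t x) <= (1 - C^-1) * hnorm x.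
  apply: (posM_bound Hdot HM) => // y.
  by rewrite /t rdotBl rdotZl mulrBl mul1r lerB // ler_wpM2l.
have [Mt _ _] := pt; have [tD tB t0 tZ _] := linear_rules (vna_lin HM Mt).
pose g := fix g n x := if n is m.+1 then rscale C^-1 x + t (g m x) else 0.
have [n|n|n x|G [pG gG G1]] := @poly_cone_cvg t g pt.
- elim: n => [|n IH]; first exact: poly_cone0.
  apply: poly_cone_add; last exact: poly_cone_mul.
  by apply: poly_cone_scale => //; exact: poly_cone_id.
- elim: n => [|n IH].
    rewrite (_ : (fun x => _) = fun x => rscale C^-1 x).
      by apply: poly_cone_scale => //; exact: poly_cone_id.
    by apply/funext => x; rewrite /= t0 addr0 subr0.
  rewrite (_ : (fun x => _) = fun x => t (g n.+1 x - g n x)).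
    exact: poly_cone_mul IH.
  by apply/funext => x; rewrite tB /= opprD addrACA subrr add0r.
- elim: n => [|n IH]; first by rewrite hnorm0 hnorm_ge0.
  apply: (le_trans (hnormD _ _)); rewrite hnormZ ger0_norm //.
  rewrite -lerBrDl -[X in X - _]mul1r -mulrBl.
  by apply: (le_trans (tq _)); rewrite ler_wpM2l.
exists G; split=> // x.
have E : G x = rscale C^-1 x + t (G x).
  apply: (hcvg_unique (hcvg_shiftS (gG x))); apply: hcvgD; first exact: hcvg_cst.
  exact: vna_cvg.
have : rscale C^-1 (h (G x)) = rscale C^-1 x.
  move: E; rewrite /t addrCA => /(congr1 (fun z => z - G x)).
  by rewrite subrr addrAC subrr add0r => /esym/eqP; rewrite subr_eq0 => /eqP.
move=> /(congr1 (rscale C)); rewrite !rscaleA divff ?gt_eqF //.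
by rewrite !rscale1.
Qed.

(** With [t = 1 - k], the iteration [r |-> (t + r ^ 2) / 2] from [0] increases to
a fixed point [S], and then [(1 - S) ^ 2 = 1 - t = k]. *)
Lemma vna_sqrt k : posM k -> (forall x, <<k x, x>> <= <<x, x>>) ->
  exists a, [/\ posM a, forall x, <<a x, x>> <= <<x, x>> & forall x, a (a x) = k x].
Proof.
move=> pk k1; pose t x := x - k x.
have pt : posM t by apply: posM_sub => //; exact: posM_id.
have t1 x : hnorm (t x) <= hnorm x.
  rewrite -[leRHS]mul1r; apply: (posM_bound Hdot HM) => // y.
  by rewrite mul1r rdotBl gerBl; case: pk.
have [Mt _ _] := pt.
have i2 : 0 <= 2^-1 :> R by rewrite invr_ge0.
pose r := fix r n x := if n is m.+1 then rscale 2^-1 (t x + r m (r m x)) else 0.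
have tr n : poly_cone t (r n).
  elim: n => [|n IH]; first exact: poly_cone0.
  apply: poly_cone_scale => //; apply: poly_cone_add.
    by apply: poly_cone_mul; exact: poly_cone_id.
  exact: poly_cone_comp.
have pr n : posM (r n) by exact: poly_cone_pos (tr n).
have rB n x y : r n (x - y) = r n x - r n y.
  by have [Mr _ _] := pr n; have [_ -> _ _ _] := linear_rules (vna_lin HM Mr).
have r1 n x : hnorm (r n x) <= hnorm x.
  elim: n x => [|n IH] x; first by rewrite hnorm0 hnorm_ge0.
  rewrite hnormZ ger0_norm // ler_pdivrMl //.
  apply: (le_trans (hnormD _ _)); rewrite mulr_natl mulr2n lerD //.
  exact: le_trans (IH _) (IH _).
have [|S [pS rS S1]] := @poly_cone_cvg t r pt tr _ r1.
  elim=> [|n IH].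
    rewrite (_ : (fun x => _) = fun x => rscale 2^-1 (t x)).
      by apply: poly_cone_scale => //; apply: poly_cone_mul; exact: poly_cone_id.
    by apply/funext => x; rewrite /= addr0 subr0.
  (* Twice the increment is [r_(n+1)^2 - r_n^2 = d r_(n+1) + r_n d], where
     [d = r_(n+1) - r_n] is in the cone by induction. *)
  rewrite (_ : (fun x => _) = fun x => rscale 2^-1
    ((r n.+1 (r n.+1 x) - r n (r n.+1 x)) + r n (r n.+1 x - r n x))).
    apply: poly_cone_scale => //; apply: poly_cone_add.
      exact: (poly_cone_comp IH (tr n.+1)).
    exact: (poly_cone_comp (tr n) IH).
  apply/funext => x; rewrite rB addrA subrK.
  rewrite -[LHS]/(rscale _ _ - rscale _ _) -rscaleBr opprD addrACA subrr add0r.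
  by [].
have [MS _ _] := pS; have [SD SB S0 SZ _] := linear_rules (vna_lin HM MS).
have E x : S x = rscale 2^-1 (t x + S (S x)).
  apply: (hcvg_unique (hcvg_shiftS (rS x))); apply: hcvgZ; apply: hcvgD.
    exact: hcvg_cst.
  have rr n : hnorm (r n (r n x) - S (S x)) <=
      hnorm (r n x - S x) + hnorm (r n (S x) - S (S x)).
    apply: (le_trans (hdistD (r n (S x)) _ _)).
    by rewrite lerD2r -rB.
  apply: (hcvg_le rr).
  by rewrite -[0](addr0 0); apply: cvgD; exact: rS.
exists (fun x => x - S x); split.
- by apply: posM_sub => //; exact: posM_id.
- by move=> x; rewrite rdotBl gerBl; case: pS.
- move=> x.
  have E2 : S (S x) = S x + S x - t x.
    apply/(canRL (addrK _)); rewrite addrC -[S x in RHS]rscale1 -rscaleDl.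
    rewrite -[RHS]/(rscale 2 (S x)) [in RHS]E rscaleA divff ?pnatr_eq0 //.
    by rewrite rscale1.
  rewrite SB E2; have -> : S x - (S x + S x - t x) = t x - S x.
    by rewrite opprB addrCA opprD [S x + _]addrA subrr add0r.
  by rewrite opprB addrA subrK /t opprB addrCA subrr addr0.
Qed.

End SquareRootsAndInverses.

(** * Solving a eta = u by minimisation *)

Section RangeLemma.
Variables (R : realType) (H : completeNormedModType R[i]).
Variable dot : {dot H for @Num.conj R[i]}.
Hypothesis Hdot : hilbert_norm dot.
Variable M : set (H -> H).
Hypothesis HM : von_neumann_algebra dot M.
Local Notation "<< x , y >>" := (rdot dot x y).
Local Notation posM := (posM dot M).

Lemma double_le_of_sqr_le (p C s : R) : 0 <= C ->
  p ^+ 2 <= C * s ^+ 2 -> 2 * p <= C + s ^+ 2.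
Proof.
move=> C0 h; have [//|lt] := leP (2 * p) (C + s ^+ 2).
have s2 := sqr_ge0 s.
have : 0 <= (C - s ^+ 2) ^+ 2 by exact: sqr_ge0.
nra.
Qed.

Lemma harmonic_lt (e : R) : 0 < e -> exists N : nat, N.+1%:R^-1 < e.
Proof.
move=> e0; have /cvgrPdist_lt /(_ _ e0) [N _ hN] := @cvg_harmonic R.
by exists N; have := hN N (leqnn N); rewrite /= sub0r normrN ger0_norm.
Qed.

Variable a : H -> H.
Hypothesis pa : posM a.
Variable V : set H.
Hypothesis V0 : V 0.
Hypothesis VD : forall x y, V x -> V y -> V (x + y).
Hypothesis VZ : forall c x, V x -> V (rscale c x).
Hypothesis Va : forall x, V x -> V (a x).

(** Along a minimising sequence [y n] of [J y = ||a y||^2 - 2 <u, y>] on [V], the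
vectors [a (y n)] form a Cauchy sequence by the parallelogram identity. Since
the first variation of [J] vanishes at the infimum, their limit [eta] satisfies
[<eta, a z> = <u, z>] for [z] in [V]. Hence [a eta - u] is orthogonal to [V], and
it belongs to the closure of [V], so that it is [0]. *)
Lemma solve_in_closure u C : 0 <= C -> closure V u ->
  (forall y, V y -> <<u, y>> ^+ 2 <= C * hnorm (a y) ^+ 2) ->
  exists2 eta, closure [set a y | y in V] eta & a eta = u.
Proof.
move=> C0 Vu uC.
have [Ma sa _] := pa; have [aD aB a0 aZ _] := linear_rules (vna_lin HM Ma).
pose J y := hnorm (a y) ^+ 2 - 2 * <<u, y>>.
have J_ge y : V y -> - C <= J y.
  move=> Vy; rewrite /J lerBrDr addrC lerBlDr addrC.
  exact: double_le_of_sqr_le (uC _ Vy).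
have hJ : has_inf (J @` V).
  split; first by exists (J 0), 0.
  by exists (- C) => _ [y Vy <-]; exact: J_ge.
pose m := inf (J @` V).
have m_le y : V y -> m <= J y.
  by move=> Vy; apply: ge_inf; [case: hJ | exists y].
have ex_y n : {y | V y & J y < m + n.+1%:R^-1}.
  apply: cid2; have n0 : 0 < n.+1%:R^-1 :> R by rewrite invr_gt0.
  by have [_ [y Vy <-] Jy] := inf_adherent n0 hJ; exists y.
pose y n := s2val (ex_y n).
have Vy n : V (y n) := s2valP (ex_y n).
have Jy n : J (y n) < m + n.+1%:R^-1 := s2valP' (ex_y n).
have Jvar x z s : J (x + rscale s z) =
    J x + 2 * s * (<<a x, a z>> - <<u, z>>) + s ^+ 2 * hnorm (a z) ^+ 2.
  rewrite /J !(hnorm_sqr Hdot) aD aZ !(rdotDl, rdotDr, rdotZl, rdotZr).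
  by rewrite [<<a z, a x>>]rdotC; ring.
have var n z : V z ->
    (<<a (y n), a z>> - <<u, z>>) ^+ 2 <= n.+1%:R^-1 * hnorm (a z) ^+ 2.
  move=> Vz; apply: quadratic_ge0_discr => [|s]; first exact: sqr_ge0.
  have := m_le _ (VD (Vy n) (VZ s Vz)); rewrite Jvar.
  have := Jy n; set P := 2 * s * _; set Q := s ^+ 2 * _.
  by move: (J _) P Q _^-1 => j P Q i; lra.
have y_cauchy n N : (N <= n)%N ->
    hnorm (a (y n) - a (y N)) ^+ 2 <= 4 * N.+1%:R^-1.
  move=> Nn; pose w := rscale 2^-1 (y n + y N).
  have Vw : V w by apply/VZ/VD.
  have nN : n.+1%:R^-1 <= N.+1%:R^-1 :> R.
    by rewrite lef_pV2 ?posrE ?ltr0n // ler_nat.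
  suff -> : hnorm (a (y n) - a (y N)) ^+ 2 = 2 * J (y n) + 2 * J (y N) - 4 * J w.
    move: (Jy n) (Jy N) (m_le _ Vw) nN.
    move: (J (y n)) (J (y N)) (J w) (n.+1%:R^-1) (N.+1%:R^-1) => j1 j2 j3 i1 i2.
    by lra.
  rewrite /J !(hnorm_sqr Hdot) /w aZ aD.
  rewrite !rdotBl !rdotBr !(rdotZl, rdotZr, rdotDl, rdotDr).
  by rewrite [<<a (y N), a (y n)>>]rdotC; field.
have [eta y_eta] : exists eta, hcvg (fun n => a (y n)) eta.
  apply: hcauchy_cvg => e e0.
  have e4 : 0 < e ^+ 2 / 4 by rewrite divr_gt0 ?exprn_gt0.
  have [N hN] := harmonic_lt e4; exists N => n Nn.
  rewrite -(@ltr_pXn2r _ 2) ?nnegrE ?hnorm_ge0 ?(ltW e0) //.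
  by apply: (le_lt_trans (y_cauchy _ _ Nn)); rewrite mulrC -ltr_pdivlMr.
have eta_eq z : V z -> <<eta, a z>> = <<u, z>>.
  move=> Vz; apply/eqP; rewrite -subr_eq0 -sqrf_eq0 eq_le sqr_ge0 andbT.
  have cv : (<<a (y n), a z>> - <<u, z>>) ^+ 2 @[n --> \oo] -->
      (<<eta, a z>> - <<u, z>>) ^+ 2.
    have cB : <<a (y n), a z>> - <<u, z>> @[n --> \oo] --> <<eta, a z>> - <<u, z>>.
      by apply: cvgB; [exact: hcvg_rdot|exact: cvg_cst].
    by rewrite expr2; exact: (cvgM cB cB).
  have c0 : n.+1%:R^-1 * hnorm (a z) ^+ 2 @[n --> \oo] --> (0 : R).
    rewrite -[0](mul0r (hnorm (a z) ^+ 2)); apply: cvgM; last exact: cvg_cst.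
    exact: cvg_harmonic.
  apply: (ler_cvg_to cv c0); apply: nearW => n; exact: var.
exists eta; first by apply: hcvg_closure y_eta => n; exists (y n).
have [v Vv v_u] := hclosure_seq Vu.
have w_cvg : hcvg (fun n => a (a (y n)) - v n) (a eta - u).
  by apply: hcvgB => //; exact: (vna_cvg HM Ma).
apply/eqP; rewrite -subr_eq0; apply/eqP/hnorm0_eq0/eqP.
rewrite -sqrf_eq0 (hnorm_sqr Hdot); apply/eqP.
rewrite -(cvg_lim (@Rhausdorff R) (hcvg_rdot Hdot (y := a eta - u) w_cvg)).
rewrite (_ : (fun n => _) = fun=> 0) ?lim_cst //; apply/funext => n.
rewrite rdotC rdotBl sa eta_eq ?subrr //.
have -> : a (a (y n)) - v n = a (a (y n)) + rscale (-1) (v n).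
  by rewrite /rscale rmorphN1 scaleN1r.
by apply: VD => //; [do 2 apply: Va|exact: VZ].
Qed.

End RangeLemma.

(** * The inverse square root of an increasing sequence of forms *)

Section InverseLimit.
Variables (R : realType) (H : completeNormedModType R[i]).
Variable dot : {dot H for @Num.conj R[i]}.
Hypothesis Hdot : hilbert_norm dot.
Variable M : set (H -> H).
Hypothesis HM : von_neumann_algebra dot M.
Local Notation "<< x , y >>" := (rdot dot x y).
Local Notation posM := (posM dot M).

(** Cauchy-Schwarz for the form of [h], applied to [y] and [h^-1 z]. *)
Lemma inverse_cauchy_schwarz h g : posM h -> (forall x, h (g x) = x) ->
  forall y z, <<y, z>> ^+ 2 <= <<h y, y>> * <<g z, z>>.
Proof.
move=> [Mh sh ph] hg y z.
have := form_cauchy_schwarz (vna_lin HM Mh) sh ph y (g z).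
by rewrite sh hg [<<z, g z>>]rdotC.
Qed.

(** [inverse_cauchy_schwarz] for [h], applied to [y = g' x] and [z = x]. *)
Lemma inverse_antitone h g h' g' : posM h -> posM h' -> posM g -> posM g' ->
  (forall x, h (g x) = x) -> (forall x, h' (g' x) = x) ->
  (forall x, <<h x, x>> <= <<h' x, x>>) ->
  forall x, <<g' x, x>> <= <<g x, x>>.
Proof.
move=> ph ph' [_ _ pg] [_ _ pg'] hg hg' hh' x.
have := inverse_cauchy_schwarz ph hg (g' x) x.
have := hh' (g' x); rewrite hg' [<<x, g' x>>]rdotC => le1 le2.
have {le1 le2}: <<g' x, x>> ^+ 2 <= <<g' x, x>> * <<g x, x>>.
  by apply: (le_trans le2); rewrite ler_wpM2r.
have [->|n0] := eqVneq <<g' x, x>> 0; first by rewrite pg.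
by rewrite expr2 ler_pM2l // lt_def n0 pg'.
Qed.

Lemma orbit_sub (T : H -> H) xio : M T ->
  [set T y | y in [set x xio | x in M]] `<=` [set x xio | x in M].
Proof.
move=> MT _ [_ [x Mx <-] <-]; exists (T \o x) => //.
exact: (vna_comp HM).
Qed.

Lemma solve_in_orbit_closure a xio u C : posM a -> 0 <= C ->
  closure [set x xio | x in M] u ->
  (forall x, M x -> <<u, x xio>> ^+ 2 <= C * hnorm (a (x xio)) ^+ 2) ->
  exists2 eta, closure [set a (x xio) | x in M] eta & a eta = u.
Proof.
move=> pa C0 Vu uC; have [Ma _ _] := pa.
have [||||_ [x Mx <-]|eta V_eta <-] := @solve_in_closure _ _ _ Hdot _ HM a pa
    [set x xio | x in M] _ _ _ _ u C C0 Vu.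
- by exists (fun=> 0) => //; exact: (vna_zero HM).
- move=> _ _ [x Mx <-] [y My <-]; exists (fun z => x z + y z) => //.
  exact: (vna_add HM).
- move=> c _ [x Mx <-]; exists (fun z => rscale c (x z)) => //.
  exact: (vna_rscale HM).
- by move=> y Vy; apply: (orbit_sub Ma); exists y.
- exact: uC.
- by exists eta => //; move: V_eta; rewrite image_comp.
Qed.

(** Let [z] be in both closures. The vector [u = a z] satisfies
[|<u, y>| <= ||z|| ||a y||], so [a z = a eta] for some [eta] in the closure of
[a M xio]. Then [z - eta] is in the closure of the range of [a] and in the kernel
of [a], which are orthogonal. *)
Lemma closure_range_orbit a xio : posM a ->
  closure (range a) `&` closure [set x xio | x in M]
  = closure [set a (x xio) | x in M].
Proof.
move=> pa; have [Ma sa posa] := pa; apply/seteqP; split; last first.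
  move=> y ay; split.
    by apply: closureS ay => _ [x _ <-]; exists (x xio).
  apply: closureS ay => _ [x Mx <-]; apply: (orbit_sub Ma).
  by exists (x xio) => //; exists x.
move=> z [az Vz].
have [_ aB _ _ _] := linear_rules (vna_lin HM Ma).
have [|||x Mx|eta V_eta a_eta] := @solve_in_orbit_closure a xio (a z) (hnorm z ^+ 2).
- exact: pa.
- exact: sqr_ge0.
- have [v Vv v_z] := hclosure_seq Vz.
  apply: hcvg_closure (vna_cvg HM Ma v_z) => n.
  by apply: (orbit_sub Ma); exists (v n) => //; exact: Vv.
- rewrite sa -exprMn -real_normK ?num_real //.
  by rewrite ler_pXn2r ?nnegrE ?mulr_ge0 ?hnorm_ge0 ?cauchy_schwarz.
suff -> : z = eta by [].
have r_eta : closure (range a) eta.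
  by apply: closureS V_eta => _ [x _ <-]; exists (x xio).
have [u ru u_z] := hclosure_seq az; have [v rv v_eta] := hclosure_seq r_eta.
apply/eqP; rewrite -subr_eq0; apply/eqP/hnorm0_eq0/eqP.
rewrite -sqrf_eq0 (hnorm_sqr Hdot); apply/eqP.
rewrite -(cvg_lim (@Rhausdorff R) (hcvg_rdot Hdot (y := z - eta) (hcvgB u_z v_eta))).
rewrite (_ : (fun n => _) = fun=> 0) ?lim_cst //; apply/funext => n.
have [x1 _ <-] := ru n; have [x2 _ <-] := rv n.
by rewrite -aB sa aB a_eta subrr rdot0r.
Qed.

(** [a] is the inverse square root of the limit of the forms [1 + q n], which need
not be bounded uniformly in [n] away from [xio]. For the last property let [k] be
the square of [a] and [g] the inverse of [h = 1 + q n], so that [k <= g]. If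
[x^* x <= s^2 h], then [||a x^* z||^2 = <k x^* z, x^* z> <= <g x^* z, x^* z>],
and with [w = g x^* z] the right side is
[<z, x w> <= ||z|| ||x w|| <= s^2 ||z||^2]; finally [||x a|| = ||a x^*||]. *)
Lemma form_sum_inverse_sqrt xio (q : nat -> H -> H) C : 0 <= C ->
  (forall n, posM (q n)) ->
  (forall n x, <<q n x, x>> <= <<q n.+1 x, x>>) ->
  (forall n, <<q n xio, xio>> <= C) ->
  exists a, [/\ posM a, forall x, <<a x, x>> <= <<x, x>>,
    exists2 eta, closure [set a (x xio) | x in M] eta & a eta = xio &
    forall (s : R) x n, 0 <= s -> M x ->
      (forall z, hnorm (x z) ^+ 2 <= s ^+ 2 * (<<z, z>> + <<q n z, z>>)) ->
      forall y, hnorm (x (a y)) <= s * hnorm y].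
Proof.
move=> C0 pq q_incr qC.
pose h n x := x + q n x.
have ph n : posM (h n) by apply: posM_add => //; exact: posM_id.
have h1 n x : <<x, x>> <= <<h n x, x>>.
  by rewrite rdotDl lerDl; case: (pq n).
have [g gP] := choice (fun n => vna_inverse Hdot HM (ph n) (h1 n)).
have pg n : posM (g n) by case: (gP n).
have hg n x : h n (g n x) = x by case: (gP n) => _ ->.
have g1 n x : <<g n x, x>> <= <<x, x>> by case: (gP n).
have g_decr n x : <<g n.+1 x, x>> <= <<g n x, x>>.
  apply: (inverse_antitone (ph n) (ph n.+1) (pg n) (pg n.+1) (hg n) (hg n.+1)) => y.
  by rewrite /h !rdotDl lerD2l.
have [|n|n x|n x|k' [pk' gk' k'_ge k'1]] :=
    @vna_increasing_cvg _ _ _ Hdot _ HM (fun n x => x - g n x) 1.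
- by [].
- by apply: posM_sub => //; exact: posM_id.
- by rewrite !rdotBl lerB.
- by rewrite rdotBl mul1r gerBl; case: (pg n).
pose k x := x - k' x.
have pk : posM k.
  apply: posM_sub => // [|x]; first exact: posM_id.
  by rewrite -[leRHS]mul1r.
have k_le_g n x : <<k x, x>> <= <<g n x, x>>.
  by have := k'_ge n x; rewrite !rdotBl lerBlDr lerBlDl.
have k1 x : <<k x, x>> <= <<x, x>> by exact: le_trans (k_le_g 0%N x) (g1 _ _).
have g_k x : <<g n x, x>> @[n --> \oo] --> <<k x, x>>.
  apply: hcvg_rdot => //; have := hcvgB (hcvg_cst x) (gk' x).
  by congr hcvg; apply/funext => n; rewrite opprB addrCA subrr addr0.
have [a [pa a1 aa]] := vna_sqrt Hdot HM pk k1.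
have [Ma sa _] := pa.
have norm_a y : hnorm (a y) ^+ 2 = <<k y, y>>.
  by rewrite (hnorm_sqr Hdot) -sa aa.
exists a; split => //.
- pose C' := <<xio, xio>> + C.
  have C'0 : 0 <= C' by rewrite addr_ge0 ?rdot_ge0.
  apply: (@solve_in_orbit_closure a xio xio C') => //.
    by apply: subset_closure; exists id => //; exact: (vna_id HM).
  move=> x _; rewrite norm_a.
  have cv : C' * <<g n (x xio), x xio>> @[n --> \oo] --> C' * <<k (x xio), x xio>>.
    by apply: cvgM; [exact: cvg_cst|exact: g_k].
  rewrite -(cvg_lim (@Rhausdorff R) cv); apply: limr_ge.
    by apply/cvg_ex; eexists; exact: cv.
  apply: nearW => n; apply: (le_trans (inverse_cauchy_schwarz (ph n) (hg n) _ _)).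
  rewrite ler_wpM2r //; first by case: (pg n).
  by rewrite rdotDl lerD2l.
- move=> s x n s0 Mx xs y.
  have [S MS adj] := vna_adj HM Mx.
  have aS z : hnorm (a (S z)) <= s * hnorm z.
    rewrite -(@ler_pXn2r _ 2) ?nnegrE ?mulr_ge0 ?hnorm_ge0 // norm_a.
    apply: (le_trans (k_le_g n _)); set w := g n (S z).
    have w_z : <<h n w, w>> = <<z, x w>> by rewrite hg rdotC -adj rdotC.
    have xw : hnorm (x w) <= s ^+ 2 * hnorm z.
      have : hnorm (x w) ^+ 2 <= s ^+ 2 * (hnorm z * hnorm (x w)).
        apply: (le_trans (xs w)); rewrite -rdotDl -/(h n w) w_z.
        by rewrite ler_wpM2l ?sqr_ge0 ?rdot_le.
      have [->|n0] := eqVneq (hnorm (x w)) 0.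
        by rewrite mulr_ge0 ?sqr_ge0 ?hnorm_ge0.
      by rewrite expr2 mulrA ler_pM2r // lt_def n0 hnorm_ge0.
    have -> : <<w, S z>> = <<z, x w>> by rewrite -adj rdotC.
    apply: (le_trans (rdot_le Hdot _ _)).
    by rewrite exprMn expr2 [hnorm z ^+ 2]expr2 mulrA mulrC ler_wpM2r ?hnorm_ge0.
  have : hnorm (x (a y)) ^+ 2 <= hnorm y * (s * hnorm (x (a y))).
    rewrite (hnorm_sqr Hdot) adj sa; apply: (le_trans (rdot_le Hdot _ _)).
    by rewrite ler_wpM2l ?hnorm_ge0.
  have [->|n0] := eqVneq (hnorm (x (a y))) 0; first by rewrite mulr_ge0 ?hnorm_ge0.
  by rewrite mulrA expr2 ler_pM2r ?lt_def ?n0 ?hnorm_ge0 // mulrC.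
Qed.

End InverseLimit.

(** * Operator norms and geometric series *)

Section GeometricSeries.
Variables (R : realType) (H : completeNormedModType R[i]).
Variable dot : {dot H for @Num.conj R[i]}.
Hypothesis Hdot : hilbert_norm dot.
Variable M : set (H -> H).
Hypothesis HM : von_neumann_algebra dot M.
Local Notation "<< x , y >>" := (rdot dot x y).
Local Notation posM := (posM dot M).

Lemma opnorm_le (T : H -> H) (C : R) : 0 <= C ->
  (forall x, hnorm (T x) <= C * hnorm x) -> opnorm T <= C.
Proof.
move=> C0 TC; apply: ge_sup; first by exists (hnorm (T 0)), 0; rewrite //= hnorm0.
move=> _ [x /= x1 <-]; apply: (le_trans (TC x)).
by rewrite -[leRHS]mulr1 ler_wpM2l.
Qed.

Lemma geometric_lt (s e : R) : 0 <= s -> 0 < e -> exists n, s * 2^-1 ^+ n < e.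
Proof.
move=> s0 e0; have d0 : 0 < e / (s + 1) by rewrite divr_gt0 // ltr_wpDl.
have h1 : `|2^-1| < 1 :> R by rewrite ger0_norm ?invr_ge0 // invf_lt1 ?ltr1n.
have /cvgrPdist_lt /(_ _ d0) [N _ hN] := cvg_expr h1.
exists N; have := hN N (leqnn N).
rewrite /= sub0r normrN ger0_norm ?exprn_ge0 ?invr_ge0 // ltr_pdivlMr ?ltr_wpDl //.
by apply: le_lt_trans; rewrite mulrC ler_wpM2l ?exprn_ge0 ?invr_ge0 // lerDl.
Qed.

Lemma sum_geometric_le N : \sum_(n < N) 2^-1 ^+ n <= 2 :> R.
Proof.
suff -> : \sum_(n < N) 2^-1 ^+ n = 2 - 2 * 2^-1 ^+ N :> R.
  by rewrite gerBl mulr_ge0 ?exprn_ge0 ?invr_ge0.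
elim: N => [|N IH]; first by rewrite big_ord0 expr0 mulr1 subrr.
by rewrite big_ord_recr /= IH exprS; field.
Qed.

Lemma vna_geometric_cvg (Y : nat -> H -> H) (s : R) : 0 <= s ->
  (forall n, M (Y n)) -> (forall x, Y 0%N x = 0) ->
  (forall n x, hnorm (Y n.+1 x - Y n x) <= s * 2^-1 ^+ n.+1 * hnorm x) ->
  exists b, [/\ M b, forall x, hcvg (fun n => Y n x) (b x),
    forall n x, hnorm (b x - Y n x) <= s * 2^-1 ^+ n * hnorm x
  & forall x, hnorm (b x) <= s * hnorm x].
Proof.
move=> s0 MY Y0 dY.
have h0 n : 0 <= s * 2^-1 ^+ n by rewrite mulr_ge0 ?exprn_ge0 ?invr_ge0.
have Y_tail n m x :
    hnorm (Y (n + m)%N x - Y n x) <= s * (2^-1 ^+ n - 2^-1 ^+ (n + m)) * hnorm x.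
  elim: m => [|m IH]; first by rewrite addn0 !subrr hnorm0 mulr0 mul0r.
  rewrite addnS; apply: (le_trans (hdistD (Y (n + m)%N x) _ _)).
  have := dY (n + m)%N x; rewrite exprS; have := hnorm_ge0 x.
  move: IH; move: (_ ^+ n) (_ ^+ (n + m)) => u v; nra.
have Y_le n m x : (n <= m)%N -> hnorm (Y m x - Y n x) <= s * 2^-1 ^+ n * hnorm x.
  move=> /subnKC <-; apply: (le_trans (Y_tail _ _ _)).
  by rewrite ler_wpM2r ?hnorm_ge0 // ler_wpM2l // gerBl exprn_ge0 ?invr_ge0.
have Y_lim x : exists l, hcvg (fun n => Y n x) l.
  apply: hcauchy_cvg => e e0.
  have [N hN] := geometric_lt (mulr_ge0 s0 (hnorm_ge0 x)) e0.
  by exists N => n Nn; apply: le_lt_trans hN; rewrite mulrAC Y_le.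
have [b bP] := choice Y_lim.
have b_tail n x : hnorm (b x - Y n x) <= s * 2^-1 ^+ n * hnorm x.
  apply: (@hcvg_le_norm _ _ (fun m => Y (m + n)%N x - Y n x)).
    apply: hcvgB; last exact: hcvg_cst.
    by have := bP x; rewrite /hcvg -(cvg_shiftn n (fun n => hnorm (Y n x - b x))).
  by move=> m; rewrite Y_le // leq_addl.
have b_le x : hnorm (b x) <= s * hnorm x.
  by have := b_tail 0%N x; rewrite Y0 subr0 expr0 mulr1.
exists b; split=> //; apply: (@vna_lim _ _ _ Hdot _ HM Y b s MY) => // n x.
by have := Y_le 0%N n x (leq0n n); rewrite Y0 subr0 expr0 mulr1.
Qed.

Lemma hnorm_sqrD (x y z : H) :
  hnorm (x - z) ^+ 2 <= 2 * hnorm (x - y) ^+ 2 + 2 * hnorm (y - z) ^+ 2.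
Proof.
have := hdistD y x z; have := hnorm_ge0 (x - z).
set u := hnorm (x - z); set v := hnorm (x - y); set w := hnorm (y - z) => u0 uvw.
apply: (@le_trans _ _ ((v + w) ^+ 2)).
  by rewrite lerXn2r ?nnegrE // (le_trans u0).
by rewrite -subr_ge0 (_ : _ - _ = (v - w) ^+ 2) ?sqr_ge0 //; ring.
Qed.

(** The telescoping series [sum_n (y_(n+1) - y_n) xio] has sum [zeta], and its
squares remain summable against the weights [4 ^ (n+1) / c] because
[y_(n+1) xio] is at squared distance at most [c d / 8 ^ n] from [zeta]. The term
[n = 0] is not small, which is the reason for the part in [||zeta||^2 / c]; both
parts are bounded by the common geometric rate [1 / 2 ^ n]. *)
Lemma orbit_fast_approximation xio zeta (c d : R) : 0 < c -> 0 < d ->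
  closure [set x xio | x in M] zeta ->
  exists y : nat -> H -> H, [/\ forall n, M (y n), forall x, y 0%N x = 0,
    hcvg (fun n => y n xio) zeta &
    forall n, 4 ^+ n.+1 / c * hnorm (y n.+1 xio - y n xio) ^+ 2
       <= (8 * (c^-1 * hnorm zeta ^+ 2) + 128 * d) * 2^-1 ^+ n].
Proof.
move=> c0 d0 /hclosureP Vz.
pose e n := c * d * 8^-1 ^+ n.
have e0 n : 0 < e n by rewrite !mulr_gt0 ?exprn_gt0 ?invr_gt0.
have yP n : exists y, M y /\ hnorm (y xio - zeta) ^+ 2 <= e n.
  have se0 : 0 < Num.sqrt (e n) by rewrite sqrtr_gt0.
  have [_ [y My <-] yz] := Vz _ se0; exists y; split => //.
  rewrite -[leRHS]sqr_sqrtr ?(ltW (e0 n)) //.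
  by rewrite ler_pXn2r ?nnegrE ?hnorm_ge0 ?ltW.
have [y {}yP] := choice yP.
exists (fun n => if n is m.+1 then y m else fun=> 0).
split=> [[|n]||| [|n]] //.
- exact: (vna_zero HM).
- by case: (yP n).
- rewrite /hcvg -cvg_shiftS /=; apply/cvgrPdist_lt => r r0.
  have [|N hN] := @geometric_lt (c * d) (r ^+ 2) (ltW (mulr_gt0 c0 d0)) _.
    by rewrite exprn_gt0.
  exists N => // n /= Nn; rewrite sub0r normrN ger0_norm ?hnorm_ge0 //.
  rewrite -(@ltr_pXn2r _ 2) ?nnegrE ?hnorm_ge0 ?(ltW r0) //.
  have [_ yn] := yP n; apply: (le_lt_trans yn); apply: le_lt_trans hN.
  rewrite /e ler_wpM2l ?mulr_ge0 ?(ltW c0) ?(ltW d0) //.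
  apply: (@le_trans _ _ (2^-1 ^+ n)).
    by rewrite lerXn2r ?nnegrE ?invr_ge0 // lef_pV2 ?posrE // ler_nat.
  by rewrite ler_wiXn2l ?invr_ge0 // invf_le1 ?ler1n.
- rewrite subr0 expr1 expr0 mulr1.
  have [_] := yP 0%N; rewrite /e expr0 mulr1 => y0.
  have := hnorm_sqrD (y 0%N xio) zeta 0; rewrite !subr0 => h.
  have {h y0} : hnorm (y 0%N xio) ^+ 2 <= 2 * (c * d) + 2 * hnorm zeta ^+ 2 by lra.
  rewrite -(ler_pM2l (_ : 0 < 4 / c)) ?divr_gt0 // => /le_trans; apply.
  rewrite (_ : 4 / c * _ = 8 * d + 8 * (c^-1 * hnorm zeta ^+ 2)).
    by lra.
  by field; rewrite gt_eqF.
- have [_] := yP n; have [_] := yP n.+1; rewrite /e [8^-1 ^+ n.+1]exprS => y1 y0.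
  have := hnorm_sqrD (y n.+1 xio) zeta (y n xio); rewrite [hnorm (zeta - _)]hdistC.
  have i0 : 0 <= 8^-1 ^+ n :> R by rewrite exprn_ge0 ?invr_ge0.
  have cd0 := mulr_gt0 c0 d0.
  have z0 : 0 <= c^-1 * hnorm zeta ^+ 2 by rewrite mulr_ge0 ?sqr_ge0 ?invr_ge0 ?ltW.
  move=> h; have {h y0 y1} : hnorm (y n.+1 xio - y n xio) ^+ 2 <= 4 * (c * d) * 8^-1 ^+ n.
    have := mulr_ge0 (ltW cd0) i0; move: h y0 y1.
    move: (_ ^+ n) (hnorm _ ^+ 2) (hnorm _ ^+ 2) (hnorm _ ^+ 2) => u v w r; lra.
  rewrite -(ler_pM2l (_ : 0 < 4 ^+ n.+2 / c)) ?divr_gt0 ?exprn_gt0 //.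
  move=> /le_trans; apply.
  apply: (@le_trans _ _ (128 * d * 2^-1 ^+ n.+1)); last first.
    by rewrite ler_wpM2r ?exprn_ge0 ?invr_ge0 // lerDr mulr_ge0.
  have E : 4 ^+ n * 8^-1 ^+ n = 2^-1 ^+ n :> R.
    by rewrite -exprMn; congr (_ ^+ _); field.
  rewrite le_eqVlt; apply/orP; left; apply/eqP.
  rewrite [4 ^+ n.+2]exprS [4 ^+ n.+1]exprS [2^-1 ^+ n.+1]exprS -E.
  by move: (4 ^+ n) (8^-1 ^+ n) => u v; field; rewrite gt_eqF.
Qed.

End GeometricSeries.

(** * Sums of weighted squares and the factorization *)

Section WeightedSquares.
Variables (R : realType) (H : completeNormedModType R[i]).
Variable dot : {dot H for @Num.conj R[i]}.
Hypothesis Hdot : hilbert_norm dot.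
Variable M : set (H -> H).
Hypothesis HM : von_neumann_algebra dot M.
Local Notation "<< x , y >>" := (rdot dot x y).
Local Notation posM := (posM dot M).

Lemma rdot_suml (N : nat) (f : nat -> H) y :
  <<\sum_(i < N) f i, y>> = \sum_(i < N) <<f i, y>>.
Proof.
elim: N => [|N IH]; first by rewrite !big_ord0 rdot0l.
by rewrite !big_ord_recr /= rdotDl IH.
Qed.

Lemma posM_sum (N : nat) (f : nat -> H -> H) : (forall i, posM (f i)) ->
  posM (fun x => \sum_(i < N) f i x).
Proof.
move=> pf; elim: N => [|N IH].
  rewrite (_ : (fun x => _) = fun=> 0); first exact: (posM_zero HM).
  by apply/funext => x; rewrite big_ord0.
rewrite (_ : (fun x => _) = fun x => (\sum_(i < N) f i x) + f N x).
  exact: (posM_add HM IH (pf N)).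
by apply/funext => x; rewrite big_ord_recr.
Qed.

Lemma posM_square (w : R) x : 0 <= w -> M x ->
  exists2 p, posM p & forall z, <<p z, z>> = w * hnorm (x z) ^+ 2.
Proof.
move=> w0 Mx; have [S MS adj] := vna_adj HM Mx.
exists (fun z => rscale w (S (x z))); last first.
  by move=> z; rewrite rdotZl rdotC -adj -(hnorm_sqr Hdot).
apply: (posM_scale HM) => //; split; first exact: (vna_comp HM MS Mx).
- by move=> y z; rewrite rdotC -!adj rdotC.
- by move=> y; rewrite rdotC -adj (rdot_ge0 Hdot).
Qed.

(** [q N] is the sum over [k, n < N] of [w k n] times [(x k n)^* (x k n)]. *)
Lemma weighted_square_sums xio (w : nat -> nat -> R)
    (x : nat -> nat -> H -> H) (B : nat -> R) C :
  (forall k n, 0 <= w k n) -> (forall k n, M (x k n)) ->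
  (forall k n, w k n * hnorm (x k n xio) ^+ 2 <= B k * 2^-1 ^+ n) ->
  (forall N, \sum_(k < N) B k <= C) ->
  exists q : nat -> H -> H, [/\ forall N, posM (q N),
    forall N z, <<q N z, z>> <= <<q N.+1 z, z>>,
    forall N, <<q N xio, xio>> <= 2 * C &
    forall k n, exists N, forall z, w k n * hnorm (x k n z) ^+ 2 <= <<q N z, z>>].
Proof.
move=> w0 Mx xB BC.
pose p k n := s2val (cid2 (posM_square (w0 k n) (Mx k n))).
have pp k n : posM (p k n) := s2valP (cid2 (posM_square (w0 k n) (Mx k n))).
have pE k n z : <<p k n z, z>> = w k n * hnorm (x k n z) ^+ 2 :=
  s2valP' (cid2 (posM_square (w0 k n) (Mx k n))) z.
have p0 k n z : 0 <= <<p k n z, z>> by case: (pp k n).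
pose q N z := \sum_(k < N) \sum_(n < N) p k n z.
have qE N z : <<q N z, z>> = \sum_(k < N) \sum_(n < N) <<p k n z, z>>.
  rewrite (rdot_suml N (fun k => \sum_(n < N) p k n z)).
  by apply: eq_bigr => k _; rewrite (rdot_suml N (fun n => p k n z)).
have B0 k : 0 <= B k.
  by have := xB k 0%N; rewrite expr0 mulr1; apply: le_trans; rewrite -pE.
exists q; split.
- move=> N; apply: (@posM_sum N (fun k z => \sum_(n < N) p k n z)) => k.
  exact: (@posM_sum N (p k)).
- move=> N z; rewrite !qE big_ord_recr /= -[leLHS]addr0 lerD ?sumr_ge0 //.
  by apply: ler_sum => k _; rewrite big_ord_recr /= lerDl.
- move=> N; rewrite qE mulrC.
  apply: (@le_trans _ _ (\sum_(k < N) B k * 2)).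
    apply: ler_sum => k _; apply: (@le_trans _ _ (\sum_(n < N) B k * 2^-1 ^+ n)).
      by apply: ler_sum => n _; rewrite pE.
    by rewrite -mulr_sumr ler_wpM2l // sum_geometric_le.
  by rewrite -mulr_suml ler_wpM2r.
- move=> k n; exists (maxn k n).+1 => z; rewrite -pE qE.
  have kN : (k < (maxn k n).+1)%N by rewrite ltnS leq_maxl.
  have nN : (n < (maxn k n).+1)%N by rewrite ltnS leq_maxr.
  rewrite (bigD1 (Ordinal kN)) //= (bigD1 (Ordinal nN)) //=.
  by rewrite -addrA lerDl addr_ge0 ?sumr_ge0 // => i _; exact: sumr_ge0.
Qed.

End WeightedSquares.

Theorem theorem4p1 (R : realType) (H : completeNormedModType R[i])
    (dot : {dot H for @Num.conj R[i]}) (Hdot : hilbert_norm dot)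
    (M : set (H -> H)) (HM : von_neumann_algebra dot M)
    (xio : H) (xi : nat -> H) (gamma : nat -> R)
    (Hxi : forall k, (1 <= k)%N -> closure [set x xio | x in M] (xi k))
    (Hgamma : forall k, (1 <= k)%N -> 0 < gamma k)
    (Hsum : (\sum_(1 <= k <oo) ((gamma k)^-1 * hnorm (xi k) ^+ 2)%:E < +oo)%E) :
  exists a : H -> H,
    [/\ M a, op_le dot 0 a, op_le dot a idfun,
        closure (range a) `&` closure [set x xio | x in M]
          = closure [set a (x xio) | x in M]
      & exists (etao : H) (b : nat -> H -> H),
        [/\ (closure (range a) `&` closure [set x xio | x in M]) etao,
            a etao = xio
          & forall k, (1 <= k)%N ->
            [/\ opnorm_closure [set x \o a | x in M] (b k),
                b k etao = xi k
              & opnorm (b k) <= Num.sqrt (gamma k)]]].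
Proof.
(* The families start at k = 1; they are reindexed from 0. *)
pose c k := gamma k.+1; pose zeta k := xi k.+1.
have c0 k : 0 < c k by exact: Hgamma.
(* The error allowed in the k-th approximation, summable in k. *)
pose d k : R := 2^-1 ^+ k.
have d0 k : 0 < d k by rewrite exprn_gt0 ?invr_gt0.
have [C zetaC] : exists C, forall N, \sum_(k < N) ((c k)^-1 * hnorm (zeta k) ^+ 2) <= C.
  pose f k := (gamma k)^-1 * hnorm (xi k) ^+ 2.
  have f0 k : (1 <= k)%N -> 0 <= f k.
    by move=> k1; rewrite mulr_ge0 ?sqr_ge0 // invr_ge0 ltW // Hgamma.
  have part N : ((\sum_(1 <= k < N.+1) f k)%:E <= \sum_(1 <= k <oo) (f k)%:E)%E.
    rewrite -sumEFin; apply: nneseries_lim_ge => k k1 _.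
    by rewrite lee_fin f0.
  have : (\sum_(1 <= k <oo) (f k)%:E)%E \is a fin_num.
    by rewrite ge0_fin_numE //; apply: le_trans (part 0%N); rewrite big_geq.
  move=> /fineK fE; exists (fine (\sum_(1 <= k <oo) (f k)%:E)%E) => N.
  rewrite -lee_fin fE; apply: le_trans (part N).
  by rewrite lee_fin big_add1 /= big_mkord.
have yP k := orbit_fast_approximation HM (c0 k) (d0 k) (Hxi k.+1 isT).
have [y {}yP] := choice yP.
pose x k n z := y k n.+1 z - y k n z.
have Mx k n : M (x k n) by case: (yP k) => My _ _ _; exact: (vna_sub HM).
pose w k n := 4 ^+ n.+1 / c k.
have w0 k n : 0 <= w k n by rewrite divr_ge0 ?exprn_ge0 ?ltW.
pose B k := 8 * ((c k)^-1 * hnorm (zeta k) ^+ 2) + 128 * d k.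
have xB k n : w k n * hnorm (x k n xio) ^+ 2 <= B k * 2^-1 ^+ n.
  by case: (yP k) => _ _ _; apply.
have BC N : \sum_(k < N) B k <= 8 * C + 128 * 2.
  rewrite big_split /= -!mulr_sumr; apply: lerD; rewrite ler_wpM2l //.
    exact: zetaC.
  exact: sum_geometric_le.
have [q [pq q_incr qC qx]] := weighted_square_sums Hdot HM w0 Mx xB BC.
have C0 : 0 <= 2 * (8 * C + 128 * 2).
  by apply: le_trans (qC 0%N); case: (pq 0%N).
have [a [pa a1 [eta V_eta a_eta] xa]] :=
  form_sum_inverse_sqrt Hdot HM C0 pq q_incr qC.
have [Ma _ _] := pa.
exists a; split => //.
- by move=> z; rewrite [X in dot X]subr0; exact: (posM_dot_ge0 HM pa).
- move=> z; apply: (posM_dot_ge0 HM (T := fun z => z - a z)).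
  by apply: (posM_sub HM) => //; exact: (posM_id Hdot HM).
- exact: (closure_range_orbit Hdot HM).
pose s k := Num.sqrt (c k).
have xa_le k n z : hnorm (x k n (a z)) <= s k * 2^-1 ^+ n.+1 * hnorm z.
  have [N qN] := qx k n.
  have sh : 0 <= s k * 2^-1 ^+ n.+1.
    by rewrite mulr_ge0 ?sqrtr_ge0 ?exprn_ge0 ?invr_ge0.
  apply: (xa _ _ N sh (Mx k n)) => v.
  have sw : (s k * 2^-1 ^+ n.+1) ^+ 2 * w k n = 1.
    rewrite exprMn sqr_sqrtr ?(ltW (c0 k)) // -exprM mulnC exprM /w.
    have E : (2^-1 ^+ 2) ^+ n.+1 * 4 ^+ n.+1 = 1 :> R.
      by rewrite -exprMn (_ : _ * _ = 1) ?expr1n //; field.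
    by rewrite mulrA -[X in X / _]mulrA E mulr1 divff // gt_eqF.
  rewrite -[leLHS]mul1r -[X in X * _]sw -mulrA ler_wpM2l ?sqr_ge0 //.
  by apply: (le_trans (qN v)); rewrite lerDr rdot_ge0.
have bP k : exists b, [/\ M b, forall z, hcvg (fun n => y k n (a z)) (b z),
    forall n z, hnorm (b z - y k n (a z)) <= s k * 2^-1 ^+ n * hnorm z
  & forall z, hnorm (b z) <= s k * hnorm z].
  have [My y0 _ _] := yP k.
  apply: (vna_geometric_cvg Hdot HM (Y := fun n z => y k n (a z))) => //.
  - exact: sqrtr_ge0.
  - by move=> n; exact: (vna_comp HM (My n) Ma).
  - by move=> n z; exact: xa_le.
have [b {}bP] := choice bP.
exists eta, (fun k => b k.-1); split => //.
  by rewrite (closure_range_orbit Hdot HM).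
case=> // k _ /=; have [Mb b_lim b_tail b_le] := bP k.
have [My y0 y_lim _] := yP k.
split.
- split; first exact: (vna_bounded HM).
  move=> e e0; have [n ne] := geometric_lt (sqrtr_ge0 (c k)) e0.
  exists (y k n \o a); first by exists (y k n).
  apply: le_lt_trans ne; apply: opnorm_le => [|z].
    by rewrite mulr_ge0 ?sqrtr_ge0 ?exprn_ge0 ?invr_ge0.
  exact: b_tail.
- by apply: (hcvg_unique (b_lim eta)); rewrite a_eta.
- by apply: opnorm_le => //; exact: sqrtr_ge0.
Qed.
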